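(* Let $(X_1,M_1),\dots,(X_n,M_n)$ be i.i.d. copies of $(X,M)\sim\mathbb{P}_{X,M}$ (no assumption on the missingness mechanism), let $\{P_\theta:\theta\in\Theta\}$ be a model of distributions on $\mathbb{R}^d$, and let $$ \theta_n^{\mathrm{MMD}}\in\arg\min_{\theta\in\Theta}\frac1n\sum_{i=1}^n \mathbb{D}^2\big(P_\theta^{(M_i)},\delta_{\{X_i^{(M_i)}\}}\big). $$ Assume: (1) $\Theta$ is compact and the minimizer $$\theta_\infty^{\mathrm{MMD}}=\arg\min_{\theta\in\Theta}\mathbb{E}_{M\sim\mathbb{P}_M}\Big[\mathbb{D}^2\big(P_\theta^{(M)},\mathbb{P}_{X\mid M}^{(M)}\big)\Big]$$ exists and is unique; (2) for each $m\in\{0,1\}^d$ in the support of $\mathbb{P}_M$, the map $\theta\mapsto\Phi(P_\theta^{(m)})$ from $\Theta$ to $\mathcal{H}$ is continuous. Then $\theta_n^{\mathrm{MMD}}\to\theta_\infty^{\mathrm{MMD}}$ $\mathbb{P}_{X,M}$-almost surely as $n\to\infty$.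
   Context: $X\in\mathbb{R}^d$ is the data vector, $M\in\{0,1\}^d$ the missingness mask ($M_j=0$: $X_j$ observed; $M_j=1$: missing); $\mathbb{P}_{X,M}$ is their joint law, $\mathbb{P}_M$ the law of $M$, and $\mathbb{P}_{X\mid M=m}$ the conditional law of $X$ given $M=m$. For $m\in\{0,1\}^d$, $x^{(m)}$ is the subvector of observed coordinates $\{j:m_j=0\}$, and for a distribution $Q$ on $\mathbb{R}^d$, $Q^{(m)}$ is the law of $Y^{(m)}$ for $Y\sim Q$. Convention: in every expectation over $M$ the empty pattern $(1,\dots,1)$ is excluded, i.e. $\mathbb{E}_M[f(M)]=\sum_{m\neq(1,\dots,1)}\mathbb{P}[M=m]f(m)$ (correspondingly, terms with $M_i=(1,\dots,1)$ in the empirical sum contribute zero). $k$ is a positive definite kernel bounded by $1$, characteristic, and dimension-independent (the same formula defines it in every dimension, e.g. Gaussian kernel), with RKHS $\mathcal{H}$; $\Phi(Q)=\mathbb{E}_{Y\sim Q}[k(Y,\cdot)]\in\mathcal{H}$ is the kernel mean embedding (and $\Phi(x)=k(x,\cdot)$), and $\mathbb{D}(Q_1,Q_2)=\|\Phi(Q_1)-\Phi(Q_2)\|_{\mathcal{H}}$ is the maximum mean discrepancy. *)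

(* Defs.v *)
From HB Require Import structures.
From mathcomp Require Import all_boot all_order all_algebra.
From mathcomp Require Import all_classical all_reals all_analysis.
Set Implicit Arguments. Unset Strict Implicit. Unset Printing Implicit Defensive.
Import Order.TTheory GRing.Theory Num.Theory.
Import numFieldNormedType.Exports.
Local Open Scope classical_set_scope.
Local Open Scope ring_scope.

(* Vectors of R^p, with the product (= Borel) sigma-algebra of tuples. *)
Notation vec R p := (p.-tuple R) (only parsing).
(* Missingness masks: m_j = true  <->  coordinate j is missing. *)
Notation pattern d := (d.-tuple bool) (only parsing).
Definition all_missing (d : nat) : pattern d := [tuple true | _ < d].

Definition obs d (m : pattern d) : {set 'I_d} := [set j | ~~ tnth m j].

Definition subvec (R : realType) d (m : pattern d) (x : vec R d) : vec R #|obs m| :=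
  [tuple tnth x (enum_val i) | i < #|obs m|].

Lemma measurable_subvec (R : realType) d (m : pattern d) :
  measurable_fun [set: d.-tuple R] (@subvec R d m).
Proof.
apply/measurable_fun_tnthP => i.
have -> : (@tnth _ R ^~ i \o @subvec R d m) = (@tnth _ R ^~ (enum_val i)).
  by apply/funext => x /=; rewrite /subvec tnth_mktuple.
exact: measurable_tnth.
Qed.

HB.instance Definition _ (R : realType) d (m : pattern d) :=
  isMeasurableFun.Build _ _ _ _ (@subvec R d m) (@measurable_subvec R d m).

Definition obs_law (R : realType) d (Q : probability (d.-tuple R) R) (m : pattern d)
  : probability (#|obs m|.-tuple R) R := distribution Q (@subvec R d m).

Definition kernel_family (R : realType) := forall p : nat, vec R p -> vec R p -> R.

(* Squared MMD  D^2(Q1,Q2) = ||Phi(Q1) - Phi(Q2)||_H^2, written out with the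
   reproducing property:  E k(Y,Y') - 2 E k(Y,Z) + E k(Z,Z'). *)
Definition mmd2 (R : realType) (k : kernel_family R) p
  (Q1 Q2 : probability (p.-tuple R) R) : R :=
  Rintegral Q1 setT (fun x => Rintegral Q1 setT (fun y => k p x y))
  - 2 * Rintegral Q1 setT (fun x => Rintegral Q2 setT (fun y => k p x y))
  + Rintegral Q2 setT (fun x => Rintegral Q2 setT (fun y => k p x y)).

Definition mmd (R : realType) (k : kernel_family R) p
  (Q1 Q2 : probability (p.-tuple R) R) : R := Num.sqrt (mmd2 k Q1 Q2).

Definition good_kernel (R : realType) (k : kernel_family R) : Prop :=
  forall p : nat,
  [/\ measurable_fun [set: p.-tuple R * p.-tuple R] (fun z => k p z.1 z.2),
      (forall x y, k p x y = k p y x),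
      (forall (n : nat) (x : 'I_n -> vec R p) (c : 'I_n -> R),
          0 <= \sum_(i < n) \sum_(j < n) c i * c j * k p (x i) (x j)),
      (forall x y, `|k p x y| <= 1) &
      (forall Q1 Q2 : probability (p.-tuple R) R,
          mmd k Q1 Q2 = 0 -> forall A, measurable A -> Q1 A = Q2 A)].

Definition mutually_independent d dT (Omega : measurableType d)
  (T : measurableType dT) (R : realType) (Pr : probability Omega R)
  (Z : nat -> Omega -> T) : Prop :=
  forall (I : seq nat) (C : nat -> set T), uniq I ->
    (forall i, i \in I -> measurable (C i)) ->
    Pr (\bigcap_(i in [set` I]) (Z i @^-1` C i)) =
    (\prod_(i <- I) Pr (Z i @^-1` C i))%E.

(* Main.v *)
(** Expanding the square, the empirical criterion is the average of a bounded
loss l(theta, (x, m)) = D^2(P_theta^(m), delta_(x^(m))), whose expectation is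
the population criterion up to a constant that does not depend on theta.  The
reproducing property gives |Phi(Q1)(y) - Phi(Q2)(y)| <= D(Q1, Q2), so continuity
of theta |-> Phi(P_theta^(m)) makes the loss equicontinuous in theta uniformly in
(x, m).  By compactness, countably many parameters form 1/q-nets for all q; a
scalar strong law at each of them gives, almost surely, uniform convergence of
the criterion, and uniqueness of the minimizer concludes.

No RKHS is constructed: the pointwise bound follows from positivity of the
double integral of a positive definite kernel, applied to the Gram kernel of
(u, v) |-> t phi(y) + phi(u) - phi(v) under Q1 x Q2, for a suitable t. *)
Require Import Defs.
From HB Require Import structures.
From mathcomp Require Import all_boot all_order all_algebra.
From mathcomp Require Import all_classical all_reals all_analysis.
From mathcomp Require Import measurable_realfun ring lra zify.
Import Order.TTheory GRing.Theory Num.Theory.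
Import numFieldNormedType.Exports.
Local Open Scope classical_set_scope.
Local Open Scope ring_scope.

Set Implicit Arguments.
Unset Strict Implicit.
Unset Printing Implicit Defensive.

(** * Integration of bounded measurable functions *)

Section BoundedMeasurable.
Context {R : realType}.

(** Boundedness in place of integrability: the class is closed under products, composition and
    sections, and its members are integrable for every probability at once. *)
Definition bmfun d (T : measurableType d) (f : T -> R) : Prop :=
  measurable_fun setT f /\ exists C : R, forall x, `|f x| <= C.

Section Closure.
Context d (T : measurableType d).
Implicit Types f g : T -> R.

Lemma bmfun_cst c : bmfun (fun _ : T => c).
Proof. by split; [exact: measurable_cst | exists `|c|]. Qed.

Lemma bmfunD f g : bmfun f -> bmfun g -> bmfun (fun x => f x + g x).
Proof.
move=> [mf [C Cf]] [mg [D Dg]]; split; first exact: measurable_funD.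
by exists (C + D) => x; rewrite (le_trans (ler_normD _ _))// lerD.
Qed.

Lemma bmfunM f g : bmfun f -> bmfun g -> bmfun (fun x => f x * g x).
Proof.
move=> [mf [C Cf]] [mg [D Dg]]; split; first exact: measurable_funM.
by exists (C * D) => x; rewrite normrM ler_pM.
Qed.

Lemma bmfunZ c f : bmfun f -> bmfun (fun x => c * f x).
Proof. exact/bmfunM/bmfun_cst. Qed.

Lemma bmfunN f : bmfun f -> bmfun (fun x => - f x).
Proof.
by move=> /(bmfunZ (-1)); congr bmfun; apply/funext => x; rewrite mulN1r.
Qed.

Lemma bmfunB f g : bmfun f -> bmfun g -> bmfun (fun x => f x - g x).
Proof. by move=> bf bg; apply: bmfunD => //; exact: bmfunN. Qed.

Lemma bmfun_sum (I : Type) (s : seq I) (P : pred I) (F : I -> T -> R) :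
  (forall i, bmfun (F i)) -> bmfun (fun x => \sum_(i <- s | P i) F i x).
Proof.
move=> bF; elim: s => [|i s ih].
  by under [X in bmfun X]eq_fun do rewrite big_nil; exact: bmfun_cst.
under [X in bmfun X]eq_fun do rewrite big_cons.
by case: (P i) => //; exact: bmfunD.
Qed.

Lemma bmfun_comp d' (T' : measurableType d') (h : T' -> T) f :
  measurable_fun setT h -> bmfun f -> bmfun (fun x => f (h x)).
Proof.
move=> mh [mf [C Cf]]; split; first exact: (measurableT_comp mf mh).
by exists C.
Qed.

End Closure.

Section Integral.
Context d (T : measurableType d) (P : probability T R).
Implicit Types f g : T -> R.

Lemma bmfun_integrable f : bmfun f -> P.-integrable setT (EFin \o f).
Proof.
move=> [mf [C Cf]]; apply: measurable_bounded_integrable => //.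
  by apply: le_lt_trans (probability_le1 P _) _ => //; exact: ltry.
exists C; split; first exact: num_real.
by move=> y Cy x _; apply: le_trans (Cf x) _; exact: ltW.
Qed.

Lemma EFin_bint f : bmfun f -> (\int[P]_x f x)%:E = (\int[P]_x (f x)%:E)%E.
Proof.
move=> bf; rewrite /Rintegral fineK//.
by apply: integrable_fin_num => //; exact: bmfun_integrable.
Qed.

Lemma bint_cst c : \int[P]_x c = c.
Proof.
rewrite Rintegral_cst// -[RHS]mulr1; congr (_ * _).
by rewrite -[RHS]/(fine 1%E); congr fine; exact: probability_setT.
Qed.

Lemma bintD f g : bmfun f -> bmfun g ->
  \int[P]_x (f x + g x) = \int[P]_x f x + \int[P]_x g x.
Proof. by move=> bf bg; rewrite RintegralD//; exact: bmfun_integrable. Qed.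

Lemma bintB f g : bmfun f -> bmfun g ->
  \int[P]_x (f x - g x) = \int[P]_x f x - \int[P]_x g x.
Proof. by move=> bf bg; rewrite RintegralB//; exact: bmfun_integrable. Qed.

Lemma bintZ c f : bmfun f -> \int[P]_x (c * f x) = c * \int[P]_x f x.
Proof. by move=> bf; rewrite RintegralZl//; exact: bmfun_integrable. Qed.

Lemma bint_sum (I : Type) (s : seq I) (Q : pred I) (F : I -> T -> R) :
  (forall i, bmfun (F i)) ->
  \int[P]_x (\sum_(i <- s | Q i) F i x) = \sum_(i <- s | Q i) \int[P]_x F i x.
Proof.
move=> bF; elim: s => [|i s ih].
  by under eq_Rintegral do rewrite big_nil; rewrite big_nil bint_cst.
under eq_Rintegral do rewrite big_cons; rewrite big_cons -ih.
by case: (Q i) => //; rewrite bintD//; exact: bmfun_sum.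
Qed.

Lemma le_bint f g : bmfun f -> bmfun g -> (forall x, f x <= g x) ->
  \int[P]_x f x <= \int[P]_x g x.
Proof.
by move=> bf bg fg; apply: le_Rintegral => //; exact: bmfun_integrable.
Qed.

Lemma norm_bint_le f C : measurable_fun setT f -> (forall x, `|f x| <= C) ->
  `|\int[P]_x f x| <= C.
Proof.
move=> mf Cf; have bf : bmfun f by split=> //; exists C.
rewrite ler_norml -[X in - X](bint_cst C) -{2}(bint_cst C) -mulN1r.
rewrite -bintZ; last exact: bmfun_cst.
apply/andP; split; apply: le_bint => //; try exact: bmfun_cst.
  by move=> x; rewrite mulN1r lerNl (le_trans _ (Cf x))// -normrN ler_norm.
by move=> x; rewrite (le_trans _ (Cf x))// ler_norm.
Qed.

End Integral.

Lemma bint_distribution d d' (T : measurableType d) (T' : measurableType d')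
    (P : probability T R) (h : {mfun T >-> T'}) (f : T' -> R) : bmfun f ->
  \int[distribution P h]_y f y = \int[P]_x f (h x).
Proof.
move=> bf; rewrite /Rintegral integral_distribution//.
  by apply/measurable_EFinP; case: bf.
exact/bmfun_integrable/bmfun_comp.
Qed.

Lemma bint_dirac d (T : measurableType d) (a : T) (f : T -> R) :
  measurable_fun setT f -> \int[\d_a]_x f x = f a.
Proof.
move=> mf; rewrite /Rintegral integral_dirac//; last exact/measurable_EFinP.
by rewrite diracT mul1e.
Qed.

(** * Product measures and iterated integrals *)

Section Product.
Context d1 d2 (T1 : measurableType d1) (T2 : measurableType d2).
Variables (P : probability T1 R) (Q : probability T2 R) (F : T1 * T2 -> R).
Hypothesis bF : bmfun F.

Lemma bmfun_section1 x : bmfun (fun y => F (x, y)).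
Proof. exact: (bmfun_comp (h := pair x)). Qed.

Lemma bmfun_section2 y : bmfun (fun x => F (x, y)).
Proof. exact: (bmfun_comp (h := fun x => (x, y))). Qed.

Lemma bmfun_bint1 : bmfun (fun x => \int[Q]_y F (x, y)).
Proof.
case: (bF) => mF [C CF]; split; last first.
  exists C => x; apply: norm_bint_le => //.
  by case: (bmfun_section1 x).
apply/measurable_EFinP.
rewrite (_ : _ \o _ = fun x => \int[Q]_y (F (x, y))%:E)%E; last first.
  by apply/funext => x /=; rewrite EFin_bint//; exact: bmfun_section1.
apply: (@measurable_fubini_F _ _ _ _ _ P Q (EFin \o F)).
exact: bmfun_integrable.
Qed.

Lemma bint_prod : \int[(P \x Q)%E]_z F z = \int[P]_x \int[Q]_y F (x, y).
Proof.
rewrite /Rintegral; congr fine.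
rewrite -(@integral12_prod_meas1 _ _ _ _ _ P Q (EFin \o F)); last first.
  exact: bmfun_integrable.
by apply: eq_integral => x _; rewrite EFin_bint//; exact: bmfun_section1.
Qed.

Lemma bint_swap : \int[P]_x \int[Q]_y F (x, y) = \int[Q]_y \int[P]_x F (x, y).
Proof.
rewrite -bint_prod /Rintegral; congr fine.
rewrite -(@integral21_prod_meas1 _ _ _ _ _ P Q (EFin \o F)); last first.
  exact: bmfun_integrable.
by apply: eq_integral => x _; rewrite EFin_bint//; exact: bmfun_section2.
Qed.

End Product.
End BoundedMeasurable.

Ltac bmfun_arith := repeat first
  [ done | exact: bmfun_cst | apply: bmfunB | apply: bmfunD | apply: bmfunZ ].

(** * Maximum mean discrepancy *)

Section PositiveDefinite.
Context {R : realType} d (T : measurableType d) (Q : probability T R).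
Variable K : T * T -> R.
Hypothesis bK : bmfun K.
Hypothesis symK : forall x y, K (x, y) = K (y, x).
Hypothesis psdK : forall s : seq T, 0 <= \sum_(x <- s) \sum_(y <- s) K (x, y).

Let h x := \int[Q]_y K (x, y).
Let I := \int[Q]_x h x.
Let D := \int[Q]_x K (x, x).

Let bh : bmfun h. Proof. exact: bmfun_bint1. Qed.

(* The expectation of the quadratic form at the points of [s] completed with
   [r] independent draws from [Q]; the draws are integrated out one by one. *)
Let psd_partial_mean (r : nat) (s : seq T) :
  0 <= \sum_(x <- s) \sum_(y <- s) K (x, y) + 2 * r%:R * \sum_(x <- s) h x
       + r%:R * (r%:R - 1) * I + r%:R * D.
Proof.
elim: r s => [|r ih] s.
  by rewrite mulr0 !mul0r !addr0; exact: psdK.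
pose S := \sum_(x <- s) \sum_(y <- s) K (x, y).
pose c := S + 2 * r%:R * (\sum_(y <- s) h y) + r%:R * (r%:R - 1) * I + r%:R * D.
(* [g x] is the induction hypothesis at [x :: s]: one draw is made explicit. Integrating it against
   [Q] turns [r] draws into [r.+1]. *)
pose g x := K (x, x) + (2 * (\sum_(y <- s) K (x, y)) + (2 * r%:R * h x + c)).
have bd : bmfun (fun x => K (x, x)).
  by apply: (bmfun_comp (h := fun x => (x, x)) _ bK); exact: measurable_fun_pair.
have bs : bmfun (fun x => \sum_(y <- s) K (x, y)).
  by apply: bmfun_sum => y; exact: bmfun_section2.
have b1 : bmfun (fun x => 2 * r%:R * h x + c).
  by apply: bmfunD; [exact: bmfunZ|exact: bmfun_cst].
have b2 : bmfun (fun x => 2 * (\sum_(y <- s) K (x, y)) + (2 * r%:R * h x + c)).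
  by apply: bmfunD => //; exact: bmfunZ.
have bg : bmfun g by exact: bmfunD.
have g0 x : 0 <= g x.
  have E : \sum_(a <- s) \sum_(b <- x :: s) K (a, b) = \sum_(b <- s) K (x, b) + S.
    rewrite /S -big_split/=; apply: eq_bigr => a _.
    by rewrite big_cons symK.
  have := ih (x :: s); rewrite big_cons E !big_cons.
  by rewrite /g /c; congr (0 <= _); ring.
have : 0 <= \int[Q]_x g x by apply: Rintegral_ge0 => x _; exact: g0.
rewrite /g bintD// bintD; [|exact: bmfunZ|exact: b1].
rewrite bintD; [|exact: bmfunZ|exact: bmfun_cst].
rewrite bint_cst bintZ// bintZ// bint_sum; last by move=> y; exact: bmfun_section2.
under eq_bigr do under eq_Rintegral do rewrite symK.
rewrite -/D -/I /c -[r.+1%:R]natr1; congr (0 <= _).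
by rewrite -/S -[X in 2 * X + _]/(\sum_(y <- s) h y); ring.
Qed.

(** With [r] draws and no fixed point, the mean of the quadratic form is r(r-1)I + rD. Were I
    negative, the quadratic term would make it negative for large r. *)
Lemma psd_double_integral : 0 <= \int[Q]_x \int[Q]_y K (x, y).
Proof.
rewrite -/I leNgt; apply/negP => I0.
have nD n : n%:R * - I <= D.
  have := psd_partial_mean n.+1 [::]; rewrite !big_nil mulr0 addr0 add0r.
  rewrite -natr1 addrK -mulrA -mulrDr pmulr_rge0; last by rewrite natr1.
  by rewrite mulrN lerNl; lra.
have := nD (Num.bound `|D / - I|); rewrite leNgt => /negP; apply.
rewrite -ltr_pdivrMr ?oppr_gt0//.
exact: le_lt_trans (ler_norm _) (archi_boundP (normr_ge0 _)).
Qed.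

End PositiveDefinite.

(** * Mean embeddings and bounds on the discrepancy *)

Section MMD.
Context {R : realType} (k : kernel_family R) (hk : good_kernel k) (p : nat).
Notation E := (p.-tuple R).
Implicit Types (Q : probability E R) (x y : E).

(** The mean embedding as a function, Phi(Q)(y) = <Phi(Q), phi(y)>. *)
Definition kmean Q y := \int[Q]_x k y x.

Lemma kernel_bmfun : bmfun (fun z : E * E => k z.1 z.2).
Proof. by have [mk _ _ k1 _] := hk p; split=> //; exists 1 => z. Qed.

Lemma kernelC x y : k x y = k y x.
Proof. by have [_ + _ _ _] := hk p; apply. Qed.

Lemma kernel_le1 x y : `|k x y| <= 1.
Proof. by have [_ _ _ + _] := hk p; apply. Qed.

Lemma kernel_bmfun1 x : bmfun (k x).
Proof. exact: (bmfun_section1 kernel_bmfun x). Qed.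

Lemma kernel_bmfun2 y : bmfun ((@k p)^~ y).
Proof. exact: (bmfun_section2 kernel_bmfun y). Qed.

Lemma kernel_bmfun_diag : bmfun (fun x => k x x).
Proof.
apply: (bmfun_comp (h := fun x => (x, x)) _ kernel_bmfun).
exact: measurable_fun_pair.
Qed.

Lemma kmean_bmfun Q : bmfun (kmean Q).
Proof. exact: (bmfun_bint1 Q Q kernel_bmfun). Qed.

(** Both sides are the inner product <Phi(Q1), Phi(Q2)>. *)
Lemma kmean_swap Q1 Q2 : \int[Q1]_x kmean Q2 x = \int[Q2]_x kmean Q1 x.
Proof.
rewrite /kmean (bint_swap Q1 Q2 kernel_bmfun).
by apply: eq_Rintegral => x _; apply: eq_Rintegral => y _; rewrite kernelC.
Qed.

Lemma mmd2E Q1 Q2 : mmd2 k Q1 Q2 =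
  \int[Q1]_x kmean Q1 x - 2 * \int[Q1]_x kmean Q2 x + \int[Q2]_x kmean Q2 x.
Proof. by []. Qed.

Lemma kernel_psd (s : seq (R * E)) :
  0 <= \sum_(a <- s) \sum_(b <- s) a.1 * b.1 * k a.2 b.2.
Proof.
have [_ _ psd _ _] := hk p.
pose t := in_tuple s.
have := psd (size s) (fun i => (tnth t i).2) (fun i => (tnth t i).1).
rewrite (big_tnth _ _ s); congr (0 <= _).
by apply: eq_bigr => i _; rewrite (big_tnth _ _ s).
Qed.

Section Difference.
Variables (Q1 Q2 : probability E R) (y : E) (t : R).

(* Gram kernel of the feature map (u, v) |-> t phi(y) + phi(u) - phi(v); its
   mean under Q1 x Q2 is t phi(y) + Phi(Q1) - Phi(Q2). *)
Let A (u v u' : E) : R := t * t * k y y + t * (k u y - k v y)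
  + (t * k y u' + (k u u' - k v u')).
Let B (u v v' : E) : R := t * k y v' + (k u v' - k v v').
Let K (z : (E * E) * (E * E)) : R := A z.1.1 z.1.2 z.2.1 - B z.1.1 z.1.2 z.2.2.

Let bK : bmfun K.
Proof.
have bk (f g : (E * E) * (E * E) -> E) : measurable_fun setT f ->
    measurable_fun setT g -> bmfun (fun z => k (f z) (g z)).
  move=> mf mg; apply: (bmfun_comp (h := fun z => (f z, g z)) _ kernel_bmfun).
  exact: measurable_fun_pair.
have m11 : measurable_fun setT (fun z : (E * E) * (E * E) => z.1.1).
  by apply: (measurableT_comp measurable_fst); exact: measurable_fst.
have m12 : measurable_fun setT (fun z : (E * E) * (E * E) => z.1.2).
  by apply: (measurableT_comp measurable_snd); exact: measurable_fst.
have m21 : measurable_fun setT (fun z : (E * E) * (E * E) => z.2.1).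
  by apply: (measurableT_comp measurable_fst); exact: measurable_snd.
have m22 : measurable_fun setT (fun z : (E * E) * (E * E) => z.2.2).
  by apply: (measurableT_comp measurable_snd); exact: measurable_snd.
by repeat (first [apply: bmfunB | apply: bmfunD | apply: bmfunZ
  | apply: bmfun_cst | apply: bk => //]).
Qed.

Let symK z z' : K (z, z') = K (z', z).
Proof.
case: z z' => [u v] [u' v']; rewrite /K /A /B/=.
rewrite (kernelC u' y) (kernelC v' y) (kernelC u' u) (kernelC v' u).
by rewrite (kernelC u' v) (kernelC v' v) (kernelC u y) (kernelC v y); ring.
Qed.

Let psdK (s : seq (E * E)) : 0 <= \sum_(x <- s) \sum_(y <- s) K (x, y).
Proof.
(* A pair (u, v) stands for three weighted points, so the unweighted sum of [K] over pairs is a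
   weighted quadratic form of [k]. *)
pose ex (z : E * E) := [:: (t, y); (1, z.1); (-1, z.2)].
have := kernel_psd (flatten (map ex s)).
rewrite big_flatten/= big_map; congr (0 <= _).
apply: eq_bigr => -[u v] _; rewrite /ex 3!big_cons big_nil !addr0.
rewrite !big_flatten !big_map -!big_split/=.
apply: eq_bigr => -[u' v'] _; rewrite !big_cons !big_nil /K /A /B/=.
by ring.
Qed.

Let PQ : probability (E * E)%type R := (Q1 \x Q2)%E.

(** [K] was written as a function of u' minus a function of v' so that integrals over the product
    law split in this way. *)
Let bint_prodB (f g : E -> R) : bmfun f -> bmfun g ->
  \int[PQ]_z (f z.1 - g z.2) = \int[Q1]_u f u - \int[Q2]_v g v.
Proof.
move=> bf bg.
have b1 : bmfun (fun z : E * E => f z.1).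
  exact: (bmfun_comp measurable_fst).
have b2 : bmfun (fun z : E * E => g z.2).
  exact: (bmfun_comp measurable_snd).
rewrite [LHS](@bint_prod _ _ _ _ _ Q1 Q2); last exact: bmfunB.
rewrite (eq_Rintegral _ (g := fun u => f u - \int[Q2]_v g v)); last first.
  by move=> u _ /=; rewrite bintB// ?bint_cst//; exact: bmfun_cst.
by rewrite bintB ?bint_cst//; exact: bmfun_cst.
Qed.

(** The quantity is the squared norm of t phi(y) + Phi(Q1) - Phi(Q2), obtained as the double
    integral of [K] under [PQ]. *)
Lemma mmd2_shift_ge0 :
  0 <= t * t * k y y + 2 * t * (kmean Q1 y - kmean Q2 y) + mmd2 k Q1 Q2.
Proof.
have := psd_double_integral PQ bK symK psdK.
(* Integrating out the second pair leaves [f u - g v], again a difference that splits. *)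
pose f u := t * t * k y y + t * (kmean Q1 y - kmean Q2 y)
  + (t * k u y + (kmean Q1 u - kmean Q2 u)).
pose g v := t * k v y + (kmean Q1 v - kmean Q2 v).
have bk := kernel_bmfun1; have bk2 := kernel_bmfun2; have bm := kmean_bmfun.
rewrite (eq_Rintegral _ (g := fun z => f z.1 - g z.2)); last first.
  move=> [u v] _; rewrite -[LHS]/(\int[PQ]_z (A u v z.1 - B u v z.2)).
  rewrite bint_prodB; [|by bmfun_arith|by bmfun_arith].
  rewrite /A /B !(bintB, bintD, bintZ, bint_cst); try by bmfun_arith.
  by rewrite /f /g /kmean/=; ring.
rewrite bint_prodB; [|by rewrite /f; bmfun_arith|by rewrite /g; bmfun_arith].
rewrite /f /g !(bintB, bintD, bintZ, bint_cst); try by bmfun_arith.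
rewrite mmd2E (kmean_swap Q2 Q1) => /le_trans; apply.
rewrite le_eqVlt; apply/orP; left; apply/eqP.
have kmeanE Q : \int[Q]_x k x y = kmean Q y.
  by apply: eq_Rintegral => x _; rewrite kernelC.
by rewrite !kmeanE; ring.
Qed.

End Difference.

Lemma mmd2_ge0 Q1 Q2 : 0 <= mmd2 k Q1 Q2.
Proof.
by have := mmd2_shift_ge0 Q1 Q2 point 0; rewrite !(mul0r, mulr0) !add0r.
Qed.

(** Cauchy-Schwarz: with u the difference on the left, the shift t = -u gives u^2 k(y,y) - 2 u^2 +
    D^2 >= 0, and k(y,y) <= 1. *)
Lemma kmean_le_mmd Q1 Q2 y : `|kmean Q1 y - kmean Q2 y| <= mmd k Q1 Q2.
Proof.
rewrite -sqrtr_sqr /mmd ler_sqrt ?mmd2_ge0//.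
set u := kmean Q1 y - kmean Q2 y.
have := mmd2_shift_ge0 Q1 Q2 y (- u); rewrite -/u.
have : k y y <= 1 by exact: le_trans (ler_norm _) (kernel_le1 _ _).
by have := sqr_ge0 u; rewrite expr2; nra.
Qed.

Lemma mmd2_dirac Q x :
  mmd2 k Q \d_x = \int[Q]_y kmean Q y - 2 * kmean Q x + k x x.
Proof.
have kd y : kmean (\d_x : probability E R) y = k y x.
  by rewrite /kmean bint_dirac//; case: (kernel_bmfun1 y).
rewrite mmd2E; congr (_ - 2 * _ + _).
  by apply: eq_Rintegral => y _; rewrite kd kernelC.
by rewrite bint_dirac ?kd//; case: (kmean_bmfun \d_x).
Qed.

(** The difference of squared norms of Phi(Q1) and Phi(Q2) is the integral of Phi(Q1) - Phi(Q2)
    under Q1 plus that under Q2. Together with twice the value at x, this makes four terms, each at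
    most D(Q1, Q2). *)
Lemma mmd2_dirac_lip Q1 Q2 x :
  `|mmd2 k Q1 \d_x - mmd2 k Q2 \d_x| <= 4 * mmd k Q1 Q2.
Proof.
rewrite !mmd2_dirac.
have bm := kmean_bmfun.
have bd : bmfun (fun y => kmean Q1 y - kmean Q2 y) by exact: bmfunB.
have H Q : `|\int[Q]_y (kmean Q1 y - kmean Q2 y)| <= mmd k Q1 Q2.
  by apply: norm_bint_le => [|y]; [case: bd|exact: kmean_le_mmd].
have := H Q1; have := H Q2; rewrite !bintB// (kmean_swap Q2 Q1).
have := kmean_le_mmd Q1 Q2 x.
by rewrite !ler_norml => /andP[? ?] /andP[? ?] /andP[? ?]; apply/andP; split; lra.
Qed.

Lemma mmd2_dirac_bmfun Q : bmfun (fun x => mmd2 k Q \d_x).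
Proof.
under [X in bmfun X]eq_fun do rewrite mmd2_dirac.
apply: bmfunD; last exact: kernel_bmfun_diag.
by apply: bmfunB; [exact: bmfun_cst|apply: bmfunZ; exact: kmean_bmfun].
Qed.

(** Bias-variance decomposition in the RKHS: the bracket is the variance of phi(Y) for Y ~ Q2 and
    does not involve [Q1]. *)
Lemma bint_mmd2_dirac Q1 Q2 : \int[Q2]_x mmd2 k Q1 \d_x =
  mmd2 k Q1 Q2 + (\int[Q2]_x k x x - \int[Q2]_x kmean Q2 x).
Proof.
rewrite mmd2E; under eq_Rintegral do rewrite mmd2_dirac.
have bm := kmean_bmfun.
rewrite bintD; [|by apply: bmfunB; [exact: bmfun_cst|exact: bmfunZ]
  |exact: kernel_bmfun_diag].
rewrite bintB; [|exact: bmfun_cst|exact: bmfunZ].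
by rewrite bint_cst bintZ// (kmean_swap Q2 Q1); ring.
Qed.

End MMD.

(** * Strong law of large numbers *)

Lemma nneseries_lty_cvg0 (R : realType) (u : nat -> R) :
  (forall n, 0 <= u n) -> (\sum_(n <oo) (u n)%:E < +oo)%E -> u @ \oo --> 0.
Proof.
move=> u0 uoo.
have fu : (\sum_(n <oo) (u n)%:E)%E \is a fin_num.
  by rewrite ge0_fin_numE// nneseries_ge0// => n _ _; rewrite lee_fin.
apply: cvg_series_cvg_0; apply: nondecreasing_is_cvgn.
  by apply/nondecreasing_seqP => n; rewrite /series/= big_nat_recr//= lerDl.
exists (fine (\sum_(n <oo) (u n)%:E)%E) => _ [n _ <-].
rewrite -lee_fin fineK// /series/= -sumEFin.
by apply: nneseries_lim_ge => k _ _; rewrite lee_fin.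
Qed.

Lemma sum_inv_squares_le (R : realType) (n : nat) :
  \sum_(0 <= j < n) (j.+1%:R ^+ 2)^-1 <= 2 :> R.
Proof.
case: n => [|n]; first by rewrite big_nil.
(* This sharper bound survives induction: 1/a - 1/(a+1) exceeds 1/(a+1)^2 by 1/(a(a+1)^2). *)
suff : \sum_(0 <= j < n.+1) (j.+1%:R ^+ 2)^-1 <= 2 - n.+1%:R^-1 :> R.
  by move=> /le_trans; apply; rewrite lerBlDr lerDl.
elim: n => [|n ih]; first by rewrite big_nat1 expr1n invr1; lra.
rewrite big_nat_recr//=; apply: le_trans (lerD ih (lexx _)) _.
rewrite -[n.+2%:R]natr1; set a := n.+1%:R.
have a0 : 0 < a by rewrite ltr0n.
have -> : 2 - a^-1 + ((a + 1) ^+ 2)^-1 =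
          2 - (a + 1)^-1 - (a * (a + 1) ^+ 2)^-1 by field; lra.
by rewrite lerBlDr lerDl invr_ge0 mulr_ge0 ?exprn_ge0//; lra.
Qed.

Lemma nat_sqrt_ex n : exists j, (j ^ 2 <= n < j.+1 ^ 2)%N.
Proof.
elim: n => [|n [j /andP[jn nj]]]; first by exists 0%N.
have [nj'|nj'] := ltnP n.+1 (j.+1 ^ 2)%N.
  by exists j; rewrite nj' andbT leqW.
by exists j.+1; rewrite nj' /= (leq_ltn_trans nj)// ltn_exp2r.
Qed.

Section StrongLaw.
Context {R : realType} d (Omega : measurableType d) (Pr : probability Omega R).
Variables (Y : nat -> Omega -> R) (B : R).
Hypothesis mY : forall i, measurable_fun setT (Y i).
Hypothesis leB : forall i w, `|Y i w| <= B.
Hypothesis uncorrelated :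
  forall i j, i != j -> \int[Pr]_w (Y i w * Y j w) = 0.

Let S n w := \sum_(i < n) Y i w.

Let bY i : bmfun (Y i).
Proof. by split=> //; exists B. Qed.

Let bS n : bmfun (S n).
Proof. exact: bmfun_sum. Qed.

Let B0 : 0 <= B.
Proof. exact: le_trans (normr_ge0 _) (leB 0 point). Qed.

(** Off-diagonal terms of the expanded square vanish, and each of the n diagonal ones is at most
    B^2. *)
Let second_moment_le n : \int[Pr]_w (S n w ^+ 2) <= n%:R * B ^+ 2.
Proof.
have bYY i j : bmfun (fun w => Y i w * Y j w) by exact: bmfunM.
rewrite (eq_Rintegral _
    (g := fun w => \sum_(i < n) \sum_(j < n) Y i w * Y j w)); last first.
  by move=> w _; rewrite expr2 /S mulr_suml; under eq_bigr do rewrite mulr_sumr.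
rewrite bint_sum; last by move=> i; exact: bmfun_sum.
apply: (@le_trans _ _ (\sum_(i < n) B ^+ 2)); last first.
  by rewrite sumr_const card_ord mulr_natl.
apply: ler_sum => i _; rewrite bint_sum// (bigD1 i)//= big1 ?addr0; last first.
  by move=> j ji; rewrite uncorrelated// eq_sym.
apply: le_trans (ler_norm _) _; apply: norm_bint_le => [|w].
  by case: (bYY i i).
by rewrite normrM expr2 ler_pM.
Qed.

(* Along the squares the second moments are summable; boundedness of [Y] then
   controls [S] between two consecutive squares. *)
Let T j w := (S (j.+1 ^ 2) w / j.+1%:R ^+ 2) ^+ 2.

Let bT j : bmfun (T j).
Proof.
have b1 : bmfun (fun w => S (j.+1 ^ 2) w / j.+1%:R ^+ 2).
  by apply: bmfunM => //; exact: bmfun_cst.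
by under [X in bmfun X]eq_fun do rewrite /T expr2; exact: bmfunM.
Qed.

Let ET_le j : \int[Pr]_w T j w <= B ^+ 2 / j.+1%:R ^+ 2.
Proof.
have -> : \int[Pr]_w T j w =
    (j.+1%:R ^+ 4)^-1 * \int[Pr]_w (S (j.+1 ^ 2) w ^+ 2).
  rewrite -bintZ; last first.
    by under [X in bmfun X]eq_fun do rewrite expr2; exact: bmfunM.
  by apply: eq_Rintegral => w _; rewrite /T; field; rewrite addrC natr1.
rewrite ler_pdivrMl ?exprn_gt0//.
apply: le_trans (second_moment_le _) _; rewrite natrX le_eqVlt; apply/orP; left.
by apply/eqP; field; rewrite addrC natr1.
Qed.

(** The expectation of the series of the [T j] is at most 2 B^2, so the series is finite almost
    everywhere and its terms tend to 0. *)
Let ae_T_cvg0 : {ae Pr, forall w, T ^~ w @ \oo --> 0}.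
Proof.
have T0 j w : 0 <= T j w by rewrite /T sqr_ge0.
have mT j : measurable_fun setT (EFin \o T j).
  by apply/measurable_EFinP; case: (bT j).
have T0' j w : setT w -> (0 <= (EFin \o T j) w)%E by rewrite lee_fin.
pose F w := (\sum_(j <oo) (T j w)%:E)%E.
have F0 w : (0 <= F w)%E by apply: nneseries_ge0 => n _ _; exact: T0'.
have mF : measurable_fun setT F.
  apply: (@ge0_emeasurable_sum _ _ _ setT (fun j => EFin \o T j) xpredT).
    by move=> j w _ _; exact: T0'.
  by move=> j _; exact: mT.
have IF : (\int[Pr]_w F w <= (2 * B ^+ 2)%:E)%E.
  rewrite [leLHS](integral_nneseries _ measurableT mT T0').
  apply: lime_le.
    by apply: is_cvg_nneseries => n _ _; apply: integral_ge0 => w _; exact: T0'.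
  apply: nearW => n.
  rewrite (eq_bigr (fun j => (\int[Pr]_w T j w)%:E)); last first.
    by move=> j _; rewrite EFin_bint.
  rewrite sumEFin lee_fin.
  apply: (@le_trans _ _ (\sum_(0 <= j < n) B ^+ 2 / j.+1%:R ^+ 2)).
    by apply: ler_sum => j _; exact: ET_le.
  by rewrite -mulr_sumr mulrC ler_wpM2r ?sqr_ge0// sum_inv_squares_le.
have iF : Pr.-integrable setT F.
  apply/integrableP; split=> //.
  under eq_integral do rewrite gee0_abs//.
  exact: le_lt_trans IF (ltry _).
apply: filterS (integrable_ae measurableT iF) => w /(_ I) Fw.
apply: nneseries_lty_cvg0 => //.
by move: Fw; rewrite ge0_fin_numE.
Qed.

Let sum_gap m n w : (m <= n)%N -> `|S n w| <= `|S m w| + (n - m)%:R * B.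
Proof.
move=> /subnKC <-; rewrite /S big_split_ord/= addKn.
apply: le_trans (ler_normD _ _) _; rewrite lerD2l.
apply: le_trans (ler_norm_sum _ _ _) _.
apply: (@le_trans _ _ (\sum_(i < n - m) B)); first exact: ler_sum.
by rewrite sumr_const card_ord mulr_natl.
Qed.

Theorem uncorrelated_strong_law :
  {ae Pr, forall w, n%:R^-1 * (\sum_(i < n) Y i w) @[n --> \oo] --> 0}.
Proof.
apply: filterS ae_T_cvg0 => w Tw.
apply/cvgrPdist_le => e e0.
have e2 : 0 < (e / 2) ^+ 2 by rewrite exprn_gt0// divr_gt0.
move/cvgrPdist_le : Tw => /(_ _ e2)[N _ NT].
(* [T] at index j-1 concerns the square j^2, hence [N.+1]; the second bound ensures 4B <= ej. *)
pose J := maxn N.+1 (Num.bound (4 * B / e)).+1.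
exists (J ^ 2)%N => // n /= Jn; rewrite sub0r normrN.
have [j /andP[jn nj]] := nat_sqrt_ex n.
have Jj : (J <= j)%N.
  by rewrite -ltnS -(@ltn_exp2r _ _ 2)// (leq_ltn_trans Jn).
have [Nj bj] : (N < j)%N /\ (Num.bound (4 * B / e) < j)%N.
  by split; apply: leq_trans Jj; rewrite leq_max leqnn ?orbT.
have j0 : (0 < j)%N by exact: leq_ltn_trans Nj.
have jR : 0 < j%:R :> R by rewrite ltr0n.
have jnR : j%:R ^+ 2 <= n%:R :> R by rewrite -natrX ler_nat.
have nR : 0 < n%:R :> R by apply: lt_le_trans jnR; rewrite exprn_gt0.
have Sj : `|S (j ^ 2) w| <= e / 2 * j%:R ^+ 2.
  have := NT j.-1; rewrite /= -ltnS prednK// => /(_ Nj).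
  rewrite sub0r normrN /T prednK// normrX ler_sqr ?nnegrE ?divr_ge0 ?(ltW e0)//.
  by rewrite normrM normfV [X in _ / X]ger0_norm ?exprn_ge0// ler_pdivrMr ?exprn_gt0.
have Bj : 4 * B <= e * j%:R.
  rewrite -ler_pdivrMl// mulrC.
  apply: le_trans (ltW (archi_boundP _)) _; last by rewrite ler_nat ltnW.
  by rewrite divr_ge0 ?mulr_ge0// ltW.
rewrite normrM normfV normr_nat ler_pdivrMl//.
apply: le_trans (sum_gap w jn) _.
(* From n < (j+1)^2. The gap then costs at most 2jB <= (e/2) j^2, which with the bound on
   [S (j ^ 2)] gives e j^2 <= e n. *)
have nj2 : (n - j ^ 2)%:R <= 2 * j%:R :> R by rewrite -natrM ler_nat; lia.
have /le_trans : (n - j ^ 2)%:R * B <= 2 * j%:R * B by rewrite ler_wpM2r.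
move=> H; apply: (@le_trans _ _ (e / 2 * j%:R ^+ 2 + 2 * j%:R * B)).
  by rewrite lerD// H.
by rewrite expr2 in jnR *; nra.
Qed.

End StrongLaw.

(** * The strong law for bounded functions of i.i.d. variables *)

Section IID.
Context {R : realType} d d' (Omega : measurableType d) (T : measurableType d').
Variables (Pr : probability Omega R) (mu : probability T R).
Variable Z : nat -> Omega -> T.
Hypothesis mZ : forall i, measurable_fun setT (Z i).
Hypothesis Zmu : forall i A, measurable A -> Pr (Z i @^-1` A) = mu A.
Hypothesis indepZ : mutually_independent Pr Z.

(** The law of the pair is [mu \x mu]: independence over [[:: i; j]] gives this on rectangles, and
    uniqueness of the product measure extends it. *)
Lemma bint_pair_indep (f : T * T -> R) i j : i != j -> bmfun f ->
  \int[Pr]_w f (Z i w, Z j w) = \int[mu]_x \int[mu]_y f (x, y).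
Proof.
move=> ij bf; rewrite -(bint_prod mu mu bf).
have mh : measurable_fun setT (fun w => (Z i w, Z j w)).
  exact: measurable_fun_pair.
pose h : {mfun Omega >-> (T * T)%type} := mfun_Sub (mem_set mh).
rewrite -[LHS](bint_distribution Pr h bf) /Rintegral; congr fine.
apply/esym/eq_measure_integral => C mC _.
apply: product_measure_unique mC => A B mA mB /=.
rewrite /pushforward/=.
pose D l := if l == i then A else B.
have := indepZ (I := [:: i; j]) (C := D).
rewrite /= inE ij => /(_ isT) H.
have {H} := H (fun l _ => ltac:(by rewrite /D; case: ifP)).
rewrite !big_cons big_nil mule1 /D eqxx (eq_sym j i) (negbTE ij).
rewrite !Zmu// => <-; congr (Pr _); apply/seteqP; split => w /=.
  by move=> [Aw Bw] l /=; rewrite !inE => /orP[/eqP ->|/eqP ->];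
    rewrite ?eqxx// (eq_sym j i) (negbTE ij).
move=> H; split.
  by have := H i; rewrite /= inE eqxx => /(_ isT).
by have := H j; rewrite /= !inE eqxx orbT (eq_sym j i) (negbTE ij) => /(_ isT).
Qed.

Theorem iid_strong_law (g : T -> R) : bmfun g ->
  {ae Pr, forall w,
     n%:R^-1 * (\sum_(i < n) g (Z i w)) @[n --> \oo] --> \int[mu]_z g z}.
Proof.
move=> bg; set m := \int[mu]_z g z.
have bgm : bmfun (fun z => g z - m) by apply: bmfunB => //; exact: bmfun_cst.
have Em : \int[mu]_z (g z - m) = 0.
  by rewrite bintB ?bint_cst ?subrr//; exact: bmfun_cst.
have [B gB] : exists B, forall z, `|g z - m| <= B by case: bgm => _.
pose Y i w := g (Z i w) - m.
have mY i : measurable_fun setT (Y i).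
  by case: (bmfun_comp (mZ i) bgm).
have YY i j : i != j -> \int[Pr]_w (Y i w * Y j w) = 0.
  move=> ij; pose f z := (g z.1 - m) * (g z.2 - m).
  have bf : bmfun f.
    by apply: bmfunM; [exact: (bmfun_comp measurable_fst bgm)
                      |exact: (bmfun_comp measurable_snd bgm)].
  rewrite [LHS](bint_pair_indep ij bf) /f/=.
  rewrite (eq_Rintegral _ (g := fun=> 0)) ?bint_cst// => x _.
  by rewrite bintZ// Em mulr0.
apply: filterS (uncorrelated_strong_law mY (fun i w => gB (Z i w)) YY) => w Yw.
rewrite -[X in _ --> X]add0r.
apply: cvg_trans (cvgD Yw (@cvg_cst _ m _ \oo _)).
(* The mean can be added back only for n > 0: at n = 0 the empirical average is 0. *)
apply: near_eq_cvg; near=> n.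
have n0 : n%:R != 0 :> R by rewrite pnatr_eq0 -lt0n; near: n; exists 1%N.
rewrite -[LHS]/(n%:R^-1 * (\sum_(i < n) (g (Z i w) - m)) + m).
rewrite sumrB sumr_const card_ord -(mulr_natl m) mulrBr mulKf//.
by rewrite subrK.
Unshelve. all: by end_near. Qed.

End IID.

(** * Consistency of M-estimators *)

Lemma filter_forall_seq (I : eqType) (J : Type) (F : set_system J)
    (s : seq I) (Q : I -> J -> Prop) : Filter F ->
  (forall i, i \in s -> \forall j \near F, Q i j) ->
  \forall j \near F, forall i, i \in s -> Q i j.
Proof.
move=> FF; elim: s => [|a s ih] H; first exact: nearW.
have H1 := H a (mem_head _ _).
have H2 : \forall j \near F, forall i, i \in s -> Q i j.
  by apply: ih => i si; apply: H; rewrite inE si orbT.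
apply: filterS2 H1 H2 => j Qa Qs i.
by rewrite inE => /orP[/eqP ->|] //; exact: Qs.
Qed.

Section MEstimator.
Context {R : realType} d d' (Omega : measurableType d) (T : measurableType d').
Variables (Pr : probability Omega R) (mu : probability T R).
Variable Z : nat -> Omega -> T.
Hypothesis mZ : forall i, measurable_fun setT (Z i).
Hypothesis Zmu : forall i A, measurable A -> Pr (Z i @^-1` A) = mu A.
Hypothesis indepZ : mutually_independent Pr Z.
Context (Theta : topologicalType).
Hypothesis cTheta : compact [set: Theta].
Variable loss : Theta -> T -> R.
Hypothesis bloss : forall theta, bmfun (loss theta).
Hypothesis equicont : forall theta0 (e : R), 0 < e ->
  \forall theta \near theta0, forall z, `|loss theta z - loss theta0 z| <= e.

Let risk theta := \int[mu]_z loss theta z.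
Let emp_risk n w theta := n%:R^-1 * \sum_(i < n) loss theta (Z i w).

Let risk_lip theta theta' (e : R) :
  (forall z, `|loss theta z - loss theta' z| <= e) ->
  `|risk theta - risk theta'| <= e.
Proof.
move=> H; rewrite /risk -bintB//; apply: norm_bint_le => //.
by case: (bmfunB (bloss theta) (bloss theta')).
Qed.

Let emp_risk_lip n w theta theta' (e : R) :
  0 <= e -> (forall z, `|loss theta z - loss theta' z| <= e) ->
  `|emp_risk n w theta - emp_risk n w theta'| <= e.
Proof.
move=> e0 H; rewrite /emp_risk -mulrBr -sumrB normrM normfV normr_nat.
have [->|n0] := posnP n; first by rewrite invr0 mul0r.
rewrite ler_pdivrMl ?ltr0n//; apply: le_trans (ler_norm_sum _ _ _) _.
apply: (@le_trans _ _ (\sum_(i < n) e)); first exact: ler_sum.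
by rewrite sumr_const card_ord mulr_natl.
Qed.

(** [Theta] carries no metric; nets are taken for the uniform distance between losses. *)
Let finite_net (e : R) : 0 < e -> exists s : seq Theta, forall theta,
  exists2 t, t \in s & forall z, `|loss theta z - loss t z| <= e.
Proof.
move=> e0.
(* Lists ordered by inclusion form a filter, so near-covering compactness merges the local choices
   into one list. *)
pose F := filter_from setT (fun s : seq Theta => [set s' : seq Theta | {subset s <= s'}]).
have FF : Filter F.
  apply: filter_from_filter; first by exists [::].
  move=> s s' _ _; exists (s ++ s') => // r sub.
  by split=> x xs; apply: sub; rewrite mem_cat xs ?orbT.
have /compact_near_coveringP := cTheta => /(_ _ F (fun s theta =>
  exists2 t, t \in s & forall z, `|loss theta z - loss t z| <= e) FF)[].
  move=> t _.
  exists ([set theta | forall z, `|loss theta z - loss t z| <= e],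
          [set s : seq Theta | t \in s]); last by move=> [theta s] [/= ? ?]; exists t.
  split; first exact: equicont.
  by exists [:: t] => // s; apply; exact: mem_head.
by move=> s _ H; exists s => theta; exact: H.
Qed.

(** Three errors are added: from theta to its net point in the empirical risk, the strong law at
    that point, and back to theta in the risk. *)
Let uniform_law : {ae Pr, forall w, forall e : R, 0 < e ->
  \forall n \near \oo, forall theta, `|emp_risk n w theta - risk theta| <= e}.
Proof.
have /choice[net netP] : forall q : nat, exists s : seq Theta, forall theta,
    exists2 t, t \in s & forall z, `|loss theta z - loss t z| <= q.+1%:R^-1.
  by move=> q; apply: finite_net; rewrite invr_gt0.
(* Net points are indexed by pairs of integers, so that the exceptional sets form a countable union;
   past the end of a list the condition is void. *)
pose P (c : nat * nat) w := forall t, ohead (drop c.2 (net c.1)) = Some t ->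
  emp_risk n w t @[n --> \oo] --> risk t.
have : {ae Pr, forall w, forall q i, P (q, i) w}.
  apply: ae_foralln => q; apply: ae_foralln => i; rewrite /P/=.
  case: ohead => [t|]; last by apply: aeW.
  apply: filterS (iid_strong_law mZ Zmu indepZ (bloss t)) => w H _ [<-].
  exact: H.
apply: filterS => w Pw e e0.
pose q := Num.bound `|3 / e|; set eq := q.+1%:R^-1 : R.
have eq0 : 0 < eq by rewrite invr_gt0.
have eqe : eq * 3 <= e.
  rewrite /eq ler_pdivrMl// -ler_pdivrMr//.
  apply: le_trans (ler_norm _) _; apply: le_trans (ltW (archi_boundP _)) _ => //.
  by rewrite ler_nat.
have : \forall n \near \oo, forall t, t \in net q ->
    `|risk t - emp_risk n w t| <= eq.
  apply: filter_forall_seq => t tq.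
  have /cvgrPdist_le : emp_risk n w t @[n --> \oo] --> risk t.
    apply: (Pw q (index t (net q)) t).
    by rewrite /= (drop_nth t) ?index_mem//= nth_index.
  exact.
apply: filterS => n Hn theta.
have [t tq Ht] := netP q theta.
have H1 := Hn _ tq.
have H2 := risk_lip Ht.
have H3 := emp_risk_lip n w (ltW eq0) Ht.
move: H1 H2 H3; rewrite !ler_norml -/eq.
by move=> /andP[? ?] /andP[? ?] /andP[? ?]; apply/andP; split; lra.
Qed.

Theorem m_estimator_consistent (theta_inf : Theta) (theta_n : nat -> Omega -> Theta) :
  (forall theta, risk theta <= risk theta_inf -> theta = theta_inf) ->
  {ae Pr, forall w, forall n, (0 < n)%N ->
     emp_risk n w (theta_n n w) <= emp_risk n w theta_inf} ->
  {ae Pr, forall w, theta_n n w @[n --> \oo] --> theta_inf}.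
Proof.
move=> uniq argmin; apply: filterS2 uniform_law argmin => w unif argmin.
have crisk : continuous risk.
  move=> t; apply/cvgrPdist_le => e e0.
  apply: filterS (equicont t e0) => t' Ht'.
  by rewrite distrC; exact: risk_lip.
move=> U /= nU; suff : \forall n \near \oo, U (theta_n n w) by [].
(* Outside the interior of [U] the risk attains a minimum by compactness, at a point [c]; the
   extreme value theorem asks for a nonempty set. *)
have [W0|] := eqVneq (~` (interior U)) set0.
  apply: nearW => n; apply: interior_subset.
  by rewrite -[interior U]setCK W0 setC0.
move=> /set0P V0.
have cV : compact (~` interior U).
  apply: (subclosed_compact _ cTheta) => //.
  by apply: open_closedC; exact: open_interior.
have [c /set_mem cU cmin] := compact_EVT_min V0 cV (continuous_subspaceT crisk).
have : risk theta_inf < risk c.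
  rewrite ltNge; apply/negP => /uniq cE; apply: cU; rewrite cE.
  exact: nU.
set dl := risk c - risk theta_inf => lt_c.
(* If the estimator lay outside the interior, its risk would be at least [risk c], yet two
   deviations of dl/3 and the argmin property keep it within 2dl/3 of [risk theta_inf]. *)
have dl0 : 0 < dl / 3 by rewrite divr_gt0// subr_gt0.

near=> n; apply: interior_subset; apply: contrapT => nin.
have n0 : (0 < n)%N by near: n; exists 1%N.
have un : forall theta, `|emp_risk n w theta - risk theta| <= dl / 3.
  by near: n; exact: unif.
have := un theta_inf; have := un (theta_n n w); have := argmin n n0.
have := cmin (theta_n n w) (mem_set nin).
rewrite !ler_norml => ? ? /andP[? ?] /andP[? ?].
have : dl = risk c - risk theta_inf by [].
by lra.
Unshelve. all: by end_near. Qed.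

End MEstimator.

(** * The loss with missing data *)

Section Conditioning.
Context {R : realType} d1 d2 (T1 : measurableType d1) (T2 : measurableType d2).
Variables (mu : probability (T1 * T2)%type R) (nu : probability T1 R) (b : T2).
Hypothesis mb : measurable [set b].
Hypothesis condb : forall A, measurable A ->
  mu (A `*` [set b]) = (mu (setT `*` [set b]) * nu A)%E.

Let D : set (T1 * T2) := setT `*` [set b].

Let mD : measurable D. Proof. exact: measurableX. Qed.

(** On [D], [mu] is the image under x |-> (x, b) of [nu] scaled by the mass of [D]; nonnegativity
    allows the change of variables before any integrability is checked. *)
Let ge0_bint_atom (f : T1 -> R) : bmfun f -> (forall x, 0 <= f x) ->
  \int[mu]_z (\1_D z * f z.1) = fine (mu D) * \int[nu]_x f x.
Proof.
move=> bf f0.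
have p0 : 0 <= fine (mu D) by rewrite fine_ge0.
have mh : measurable_fun setT (fun x : T1 => (x, b)) by exact: measurable_fun_pair.
pose h : {mfun T1 >-> (T1 * T2)%type} := mfun_Sub (mem_set mh).
pose nu' := mscale (NngNum p0) nu.
have mf : measurable_fun setT (fun z : T1 * T2 => (f z.1)%:E).
  by apply/measurable_EFinP; have [] : bmfun (fun z : T1 * T2 => f z.1)
    by exact: (bmfun_comp measurable_fst).
have mf1 : measurable_fun setT (EFin \o f) by apply/measurable_EFinP; case: bf.
rewrite /Rintegral.
rewrite (eq_integral ((fun z : T1 * T2 => (f z.1)%:E) \_ D)); last first.
  by move=> z _; rewrite patchE indicE; case: ifP; rewrite ?mul1r ?mul0r.
rewrite -integral_mkcond (eq_measure_integral (pushforward nu' h)); last first.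
  move=> A mA AD; transitivity ((fine (mu D))%:E * nu (h @^-1` A))%E; last by [].
  rewrite fineK ?fin_num_measure//.
  rewrite -condb; last first.
    rewrite -[X in measurable X]setTI.
    exact: (measurable_funP (D := setT) h).
  congr (mu _); apply/seteqP; split=> [[x y] Axy|[x y] [/= + ->]] //=.
  by have [_ /= yb] := AD _ Axy; rewrite -yb.
rewrite ge0_integral_pushforward//=; last 2 first.
- exact: measurable_funTS.
- by move=> z _; rewrite lee_fin.
rewrite (_ : _ @^-1` D = setT); last by apply/seteqP; split.
rewrite ge0_integral_mscale//=; last by move=> x _; rewrite lee_fin.
by rewrite -EFin_bint//.
Qed.

Lemma bint_atom (f : T1 -> R) : bmfun f ->
  \int[mu]_z (\1_D z * f z.1) = fine (mu D) * \int[nu]_x f x.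
Proof.
move=> bf; have [C fC] : exists C, forall x, `|f x| <= C by case: bf.
have C0 : 0 <= C by exact: le_trans (normr_ge0 _) (fC point).
have b1 : bmfun (fun z : T1 * T2 => \1_D z : R).
  split; first exact: measurable_indic.
  by exists 1 => z; rewrite indicE normr_nat; case: (_ \in _).
have bC : bmfun (fun _ : T1 => C) by exact: bmfun_cst.
have bfC : bmfun (fun x => f x + C) by exact: bmfunD.
have bp (g : T1 -> R) : bmfun g -> bmfun (fun z : T1 * T2 => \1_D z * g z.1).
  move=> bg; apply: (bmfunM b1).
  by apply: (bmfun_comp (h := fun z : T1 * T2 => z.1) _ bg); exact: measurable_fst.
(* Both f + C and C are nonnegative, which reduces to the previous case. *)
rewrite (eq_Rintegral _ (g := fun z => \1_D z * (f z.1 + C) - \1_D z * C)).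
  rewrite bintB; [|exact: (bp _ bfC)|exact: (bp _ bC)].
  rewrite (ge0_bint_atom bfC) ?(ge0_bint_atom bC)//.
    by rewrite bintD// !bint_cst; ring.
  by move=> x; rewrite -lerBlDr sub0r; have := fC x; rewrite ler_norml => /andP[].
by move=> z _; ring.
Qed.

End Conditioning.

Lemma measurable_pattern1 d (m : d.-tuple bool) : measurable [set m].
Proof.
rewrite (_ : [set m] = \bigcap_(j in [set: 'I_d])
    ((fun t : d.-tuple bool => tnth t j) @^-1` [set tnth m j])).
  apply: fin_bigcap_measurable => // j _.
  rewrite -[X in measurable X]setTI.
  exact: measurable_tnth.
apply/seteqP; split=> [t -> //|t H].
by apply: eq_from_tnth => j; exact: H.
Qed.

(** * The loss split along missingness patterns *)

Section PatternLoss.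
Context {R : realType} (d : nat) (k : kernel_family R) (hk : good_kernel k).
Variable PXM : probability (d.-tuple R * pattern d)%type R.
Implicit Types (Q : probability (d.-tuple R) R) (m : pattern d).

Definition pattern_supp m : bool :=
  (m != all_missing d) && (0 < PXM (setT `*` [set m]))%E.

(* Patterns outside the support are discarded: continuity in the parameter
   is only available on the support. *)
Definition pattern_loss Q (z : d.-tuple R * pattern d) : R :=
  if pattern_supp z.2
  then mmd2 k (obs_law Q z.2) \d_(subvec z.2 z.1) else 0.

Let loss_term Q m (x : d.-tuple R) : R := mmd2 k (obs_law Q m) \d_(subvec m x).

Let bmfun_loss_term Q m : bmfun (loss_term Q m).
Proof.
exact: (bmfun_comp (h := @subvec R d m) (@measurable_subvec R d m)
  (mmd2_dirac_bmfun hk (obs_law Q m))).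
Qed.

(** The dimension of the observed subvector varies with the pattern; fixing the pattern in each
    summand makes measurability and integration statements in a fixed dimension. *)
Let pattern_lossE Q z : pattern_loss Q z =
  \sum_(m | pattern_supp m) \1_(setT `*` [set m]) z * loss_term Q m z.1.
Proof.
have ind m : \1_([set: d.-tuple R] `*` [set m]) z = (z.2 == m)%:R :> R.
  rewrite indicE; congr (_%:R); congr nat_of_bool; apply/idP/eqP => [|zm].
    by rewrite inE => -[].
  by rewrite inE; split.
rewrite /pattern_loss big_mkcond (bigD1 z.2)//= big1 ?addr0.
  by case: ifP => // _; rewrite ind eqxx mul1r.
by move=> m mz; rewrite ind eq_sym (negbTE mz) mul0r; case: ifP.
Qed.

Let bmfun_indic_term Q m : bmfun (fun z : d.-tuple R * pattern d =>
  \1_(setT `*` [set m]) z * loss_term Q m z.1).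
Proof.
have b1 : bmfun (fun z : d.-tuple R * pattern d => \1_(setT `*` [set m]) z : R).
  split; first by apply: measurable_indic; apply: measurableX => //;
    exact: measurable_pattern1.
  by exists 1 => z; rewrite indicE normr_nat; case: (_ \in _).
apply: (bmfunM b1).
apply: (bmfun_comp (h := fun z : d.-tuple R * pattern d => z.1) _
  (bmfun_loss_term Q m)).
exact: measurable_fst.
Qed.

Lemma bmfun_pattern_loss Q : bmfun (pattern_loss Q).
Proof.
rewrite (_ : pattern_loss Q = fun z =>
    \sum_(m | pattern_supp m) \1_(setT `*` [set m]) z * loss_term Q m z.1).
  exact: bmfun_sum.
by apply/funext => z; rewrite pattern_lossE.
Qed.

Variable PXgM : pattern d -> probability (d.-tuple R) R.
Hypothesis hcond : forall m (A : set (d.-tuple R)), measurable A ->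
  PXM (A `*` [set m]) = (PXM (setT `*` [set m]) * PXgM m A)%E.

(** Conditionally on each pattern the bias-variance decomposition applies; [c] collects the weighted
    variances. Patterns of probability zero contribute nothing to either side. *)
Lemma bint_pattern_loss : exists c, forall Q,
  \int[PXM]_z pattern_loss Q z =
  \sum_(m : pattern d | m != all_missing d)
    fine (PXM (setT `*` [set m])) * mmd2 k (obs_law Q m) (obs_law (PXgM m) m) + c.
Proof.
pose e m := fine (PXM (setT `*` [set m])) *
  (\int[obs_law (PXgM m) m]_x k x x
   - \int[obs_law (PXgM m) m]_x kmean k (obs_law (PXgM m) m) x).
exists (\sum_(m : pattern d | m != all_missing d) e m) => Q.
rewrite (eq_Rintegral _ (g := fun z =>
    \sum_(m | pattern_supp m) \1_(setT `*` [set m]) z * loss_term Q m z.1));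
  last by move=> z _; exact: pattern_lossE.
rewrite bint_sum// -big_split/= [LHS]big_mkcond [RHS]big_mkcond.
apply: eq_bigr => m _; rewrite /pattern_supp; case: eqP => //= _.
have [pm|] := ltP; last first.
  rewrite le_eqVlt ltNge measure_ge0 orbF => /eqP pm0.
  by rewrite /e pm0/= !mul0r addr0.
rewrite (bint_atom (measurable_pattern1 m) (hcond m))//.
rewrite /e -mulrDr -bint_mmd2_dirac//; congr (_ * _).
exact/esym/(bint_distribution (PXgM m) (@subvec R d m) (mmd2_dirac_bmfun hk _)).
Qed.

(** There are finitely many patterns, so one neighbourhood serves them all; e/4 compensates the
    Lipschitz constant 4, which is uniform in the data. *)
Lemma pattern_loss_equicontinuous (Theta : topologicalType)
    (P : Theta -> probability (d.-tuple R) R) (theta0 : Theta) (e : R) :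
  (forall m, (0 < PXM (setT `*` [set m]))%E ->
     mmd k (obs_law (P theta) m) (obs_law (P theta0) m) @[theta --> theta0]
       --> (0 : R)) ->
  0 < e -> \forall theta \near theta0, forall z,
    `|pattern_loss (P theta) z - pattern_loss (P theta0) z| <= e.
Proof.
move=> cont e0; have e4 : 0 < e / 4 by rewrite divr_gt0.
have : \forall theta \near theta0, forall m, m \in index_enum (pattern d) ->
    pattern_supp m -> mmd k (obs_law (P theta) m) (obs_law (P theta0) m) <= e / 4.
  apply: filter_forall_seq => m _; have [ms|ms] := boolP (pattern_supp m).
    have /andP[_ /cont/cvgrPdist_le/(_ _ e4)] := ms.
    apply: filterS => theta; rewrite sub0r normrN => H _.
    exact: le_trans (ler_norm _) H.
  exact: nearW.
apply: filterS => theta H z; rewrite /pattern_loss.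
case: ifP => zs; last by rewrite subrr normr0 ltW.
apply: le_trans (mmd2_dirac_lip hk _ _ _) _.
have := H z.2 (mem_index_enum _) zs; lra.
Qed.

(** The null patterns are finite in number, hence almost surely none is drawn. This identifies the
    truncated loss with the observed criterion. *)
Lemma ae_pattern_supp dO (Omega : measurableType dO) (Pr : probability Omega R)
    (X : Omega -> d.-tuple R) (M : Omega -> pattern d) :
  measurable_fun setT (fun w => (X w, M w)) ->
  (forall C : set (d.-tuple R * pattern d)%type, measurable C ->
     Pr ((fun w => (X w, M w)) @^-1` C) = PXM C) ->
  {ae Pr, forall w, (0 < PXM (setT `*` [set M w]))%E}.
Proof.
move=> mZ hZ.
have : {ae Pr, forall w, forall m, m \in index_enum (pattern d) ->
    M w = m -> (0 < PXM (setT `*` [set m]))%E}.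
  apply: filter_forall_seq => m _.
  have [pm|] := ltP 0%E (PXM (setT `*` [set m])); first exact: aeW.
  rewrite le_eqVlt ltNge measure_ge0 orbF => /eqP pm0.
  have mC : measurable ([set: d.-tuple R] `*` [set m]).
    by apply: measurableX => //; exact: measurable_pattern1.
  exists ((fun w => (X w, M w)) @^-1` (setT `*` [set m])); split.
  - by rewrite -[X in measurable X]setTI; exact: mZ.
  - by rewrite hZ.
  - by move=> w /= /not_implyP[Mw _]; split.
by apply: filterS => w /(_ (M w) (mem_index_enum _)); exact.
Qed.

End PatternLoss.

(** * Almost sure consistency of the MMD estimator *)

Unset Implicit Arguments.
Set Strict Implicit.
Set Printing Implicit Defensive.

Theorem theorem3
  (R : realType) (d : nat)
  (* kernel *)
  (k : kernel_family R) (hk : good_kernel k)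
  (* parametric model {P_theta : theta in Theta}, Theta compact *)
  (Theta : topologicalType) (P : Theta -> probability (d.-tuple R) R)
  (hTheta : compact [set: Theta])
  (* joint law P_{X,M} and a version of the conditional laws P_{X|M=m} *)
  (PXM : probability (d.-tuple R * pattern d)%type R)
  (PXgM : pattern d -> probability (d.-tuple R) R)
  (hcond : forall (m : pattern d) (A : set (d.-tuple R)), measurable A ->
     PXM (A `*` [set m]) = (PXM (setT `*` [set m]) * PXgM m A)%E)
  (* i.i.d. sample (X_i, M_i) ~ P_{X,M} on a probability space *)
  (dO : measure_display) (Omega : measurableType dO) (Pr : probability Omega R)
  (X : nat -> Omega -> d.-tuple R) (M : nat -> Omega -> pattern d)
  (hmeas : forall i, measurable_fun [set: Omega] (fun w => (X i w, M i w)))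
  (hdist : forall i (C : set (d.-tuple R * pattern d)%type), measurable C ->
     Pr ((fun w => (X i w, M i w)) @^-1` C) = PXM C)
  (hindep : mutually_independent Pr (fun i w => (X i w, M i w)))
  (* (1) unique population minimizer *)
  (theta_inf : Theta)
  (hmin : let pM m := fine (PXM (setT `*` [set m])) in
          let L theta := \sum_(m : pattern d | m != all_missing d)
              pM m * mmd2 k (obs_law (P theta) m) (obs_law (PXgM m) m) in
          (forall theta, L theta_inf <= L theta) /\
          (forall theta, L theta <= L theta_inf -> theta = theta_inf))
  (* (2) continuity of theta |-> Phi(P_theta^(m)) in H, m in the support of P_M *)
  (hcont : forall m : pattern d, (0 < PXM (setT `*` [set m]))%E ->
     forall theta0 : Theta,
       mmd k (obs_law (P theta) m) (obs_law (P theta0) m) @[theta --> theta0]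
         --> (0 : R))
  (* empirical MMD estimators *)
  (theta_n : nat -> Omega -> Theta)
  (hargmin : let Ln n w theta := n%:R^-1 *
       \sum_(i < n | M i w != all_missing d)
          mmd2 k (obs_law (P theta) (M i w)) (\d_(subvec (M i w) (X i w))) in
     forall (n : nat) (w : Omega), (0 < n)%N ->
       forall theta, Ln n w (theta_n n w) <= Ln n w theta) :
  {ae Pr, forall w, theta_n n w @[n --> \oo] --> theta_inf}.
Proof.
have [c riskE] := bint_pattern_loss hk hcond.
apply: (m_estimator_consistent hmeas hdist hindep hTheta
  (loss := fun theta => pattern_loss k PXM (P theta))).
- by move=> theta; exact: bmfun_pattern_loss.
- by move=> theta0 e; apply: pattern_loss_equicontinuous => // m /hcont; exact.
(* The risk and the population criterion differ by the constant [c], so uniqueness transfers. *)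
- by move=> theta; rewrite !riskE lerD2r; apply: hmin.2.
(* Off one null set every sampled pattern has positive probability, and there the empirical risk is
   the criterion minimized by [theta_n]. *)
have supp : {ae Pr, forall w, forall i, (0 < PXM (setT `*` [set M i w]))%E}.
  by apply: ae_foralln => i; exact: ae_pattern_supp (hmeas i) (hdist i).
apply: filterS supp => w Mw n n0.
have := hargmin n w n0 theta_inf.
rewrite [X in _ * X <= _]big_mkcond [X in _ <= _ * X]big_mkcond/=.
congr (_ * _ <= _ * _); apply: eq_bigr => i _;
  by rewrite /pattern_loss /pattern_supp/= Mw andbT.
Qed.
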